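(* Let $n\ge 1$ and $\alpha\in[n-1,n]$. Let $\Omega\subset\mathbb{R}^n$ be a bounded measurable set with $|\Omega|>0$ whose topological boundary satisfies $$0<M_2\le \underline{\mathcal{M}}^{\alpha}(\partial\Omega)\le \overline{\mathcal{M}}^{\alpha}(\partial\Omega)\le M_1<\infty$$ for some constants $M_1,M_2>0$. Assume there is a constant $D_{\partial\Omega}>0$ such that for all $x\in\partial\Omega$ and all $t\in(0,1)$, $$\min\{|B(x,t)\cap\Omega|,\ |B(x,t)\cap\Omega^c|\}\ge D_{\partial\Omega}\, t^n .$$ Let $J\ge 0$ be a function in $L^1(\mathbb{R}^n)$ with $\int_{\mathbb{R}^n}J(z)|z|^n\,dz<\infty$, and let $C_J>0$ be a constant with $\int_{\mathbb{R}^n}J(z)|z|^{\gamma}\,dz\le C_J$ for all $\gamma\in[0,n]$. Assume further that there are constants $c_J,a_J>0$ with $J(z)\ge c_J$ whenever $|z|\le a_J$. Define, for $t>0$, $$\mathcal{J}_t(\Omega)=\int_{\Omega}\int_{\Omega^c}J\Big(\frac{x-y}{t}\Big)\,dx\,dy .$$ Then there is a constant $O_1$ depending only on $n$ and $C_J$, and a constant $O_2>0$ depending only on $n,a_J,c_J,D_{\partial\Omega}$, such that $$0<O_2 M_2\le \liminf_{t\to0^+}\frac{\mathcal{J}_t(\Omega)}{t^{2n-\alpha}}\le \limsup_{t\to0^+}\frac{\mathcal{J}_t(\Omega)}{t^{2n-\alpha}}\le O_1M_1<\infty .$$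
   Context: $|A|$ denotes Lebesgue measure, $\Omega^c=\mathbb{R}^n\setminus\Omega$, $B(x,t)$ is the open ball. For a bounded set $A\subset\mathbb{R}^n$, $B(A,t)=\{x:\mathrm{dist}(x,A)<t\}$, and the $\alpha$-dimensional upper and lower Minkowski contents are $\overline{\mathcal{M}}^{\alpha}(A)=\limsup_{t\to0^+}|B(A,t)|/t^{n-\alpha}$ and $\underline{\mathcal{M}}^{\alpha}(A)=\liminf_{t\to0^+}|B(A,t)|/t^{n-\alpha}$. *)

(* Defs.v *)
From HB Require Import structures.
From mathcomp Require Import all_boot all_order all_algebra.
From mathcomp Require Import all_classical all_reals all_analysis.
Set Implicit Arguments. Unset Strict Implicit. Unset Printing Implicit Defensive.
Import Order.TTheory GRing.Theory Num.Theory.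
Import numFieldNormedType.Exports.
Local Open Scope classical_set_scope.
Local Open Scope ring_scope.

Definition enorm {R : realType} {n : nat} (x : 'rV[R]_n) : R :=
  Num.sqrt (\sum_(i < n) x ord0 i ^+ 2).

Definition eball {R : realType} {n : nat} (x : 'rV[R]_n) (t : R) : set 'rV[R]_n :=
  [set y | enorm (y - x) < t].

Definition tube {R : realType} {n : nat} (A : set 'rV[R]_n) (t : R) : set 'rV[R]_n :=
  [set x | exists2 a, A a & enorm (x - a) < t].

Definition boundary {R : realType} {n : nat} (A : set 'rV[R]_n) : set 'rV[R]_n :=
  closure A `\` interior A.

(* boundedness: we use the library's [bounded_set] (bounded for the norm of
   'rV[R]_n, equivalent to Euclidean boundedness) *)

Definition box {R : realType} {n : nat} (a b : 'rV[R]_n) : set 'rV[R]_n :=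
  [set x | forall i : 'I_n, a ord0 i <= x ord0 i < b ord0 i].
Definition box_vol {R : realType} {n : nat} (a b : 'rV[R]_n) : R :=
  \prod_(i < n) (b ord0 i - a ord0 i).

Definition lebesgue_outer {R : realType} {n : nat} (A : set 'rV[R]_n) : \bar R :=
  ereal_inf [set s | exists a b : nat -> 'rV[R]_n,
     [/\ (forall k i, a k ord0 i <= b k ord0 i),
         A `<=` \bigcup_k box (a k) (b k) &
         s = (\sum_(k <oo) (box_vol (a k) (b k))%:E)%E]].

Definition mink_ratio {R : realType} {n : nat}
  (mu : set 'rV[R]_n -> \bar R) (alpha : R) (A : set 'rV[R]_n) (t : R) : \bar R :=
  (mu (tube A t) * ((powR t (n%:R - alpha))^-1)%:E)%E.

Definition upper_minkowski {R : realType} {n : nat}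
  (mu : set 'rV[R]_n -> \bar R) (alpha : R) (A : set 'rV[R]_n) : \bar R :=
  limf_esup (mink_ratio mu alpha A) (0^'+).
Definition lower_minkowski {R : realType} {n : nat}
  (mu : set 'rV[R]_n -> \bar R) (alpha : R) (A : set 'rV[R]_n) : \bar R :=
  limf_einf (mink_ratio mu alpha A) (0^'+).

(* J_t(Omega) = int_{x in Omega} int_{y in Omega^c} J((x-y)/t) dy dx,
   w.r.t. the Lebesgue measure mu (Caratheodory restriction of the outer measure) *)
Definition Jt {R : realType} {n : nat} (mu : {outer_measure set 'rV[R]_n -> \bar R})
  (J : 'rV[R]_n -> R) (Omega : set 'rV[R]_n) (t : R) : \bar R :=
  (\int[mu : set (caratheodory_type mu) -> \bar R]_(x in Omega)
     \int[mu : set (caratheodory_type mu) -> \bar R]_(y in ~` Omega)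
        (J (t^-1 *: (x - y)))%:E)%E.

Definition Jt_ratio {R : realType} {n : nat} (mu : {outer_measure set 'rV[R]_n -> \bar R})
  (J : 'rV[R]_n -> R) (Omega : set 'rV[R]_n) (alpha t : R) : \bar R :=
  (Jt mu J Omega t * ((powR t (2 * n%:R - alpha))^-1)%:E)%E.

(* Main.v *)
Require Import Defs.
From HB Require Import structures.
From mathcomp Require Import all_boot all_order all_algebra.
From mathcomp Require Import all_classical all_reals all_analysis.
From mathcomp Require Import measurable_realfun ring lra.
Set Implicit Arguments. Unset Strict Implicit. Unset Printing Implicit Defensive.
Import Order.TTheory GRing.Theory Num.Theory.
Import numFieldNormedType.Exports.
Local Open Scope classical_set_scope.
Local Open Scope ring_scope.

(**
Upper bound.  If [x] is in [Omega] and [y] is not, the segment from [x] to [y]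
meets the boundary, so [x] lies in the tube of radius [2^k t] around it as soon
as [(x - y)/t] lies in the dyadic shell [2^(k-1) <= |z| < 2^k].  The
substitution [z = (x - y)/t] therefore bounds [J_t] by
[t^n \sum_k m_k |Omega `&` tube (2^k t)|], where [m_k] is the mass of [J] in the
[k]-th shell.  While [2^k t] is small the Minkowski content bounds the tubes by
a multiple of [M1 (2^k t)^(n-alpha)], which sums to a moment of [J] of order
[n - alpha]; the remaining shells contribute a tail of the [n]-th moment.
Comparing with a sum over shells makes Fubini's theorem unnecessary.

Lower bound.  Take a maximal set of [N] boundary points at mutual sup-distance
at least [2r], with [r] proportional to [t].  The cubes of half-side [r] around
them are disjoint, and each contributes at least [cJ (D r^n)^2] to [J_t] by the
density hypothesis.  By maximality the cubes of half-side [3r] cover the tube of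
radius [r], so [N (6r)^n] is at least a multiple of [M2 r^(n-alpha)].
*)

(* [integral] is a supremum over simple functions below the integrand, so no
   measurability is needed here. *)
Lemma ge0_le_lower_integral (d : measure_display) (T : measurableType d)
    (R : realType) (mu : {measure set T -> \bar R}) (D : set T)
    (f g : T -> \bar R) :
  (forall x, D x -> 0 <= f x)%E -> (forall x, D x -> f x <= g x)%E ->
  (\int[mu]_(x in D) f x <= \int[mu]_(x in D) g x)%E.
Proof.
move=> f0 fg.
have g0 x : D x -> (0 <= g x)%E by move=> Dx; exact: le_trans (f0 _ Dx) (fg _ Dx).
rewrite !ge0_integralE//; apply: ge_ereal_sup => _ [h hf <-].
apply: ereal_sup_ubound; exists h => // x; apply: le_trans (hf x) _.
by rewrite /patch; case: ifPn => //; rewrite inE => /fg.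
Qed.

(** * Lebesgue outer measure: measurability of boxes and scaling under reflections *)

Section lebesgue_outer_measure.
Variables (R : realType) (n : nat).
Hypothesis n_gt0 : (0 < n)%N.
Variable mu : {outer_measure set 'rV[R]_n -> \bar R}.
Hypothesis muE : forall A, mu A = lebesgue_outer A.

Let caraT := caratheodory_type mu.
Let cara : set (set caraT) := measurable.

Lemma box_vol_ge0 (a b : 'rV[R]_n) :
  (forall i, a ord0 i <= b ord0 i) -> 0 <= box_vol a b.
Proof. by move=> ab; apply: prodr_ge0 => i _; rewrite subr_ge0. Qed.

Lemma mu_le_cover (A : set 'rV[R]_n) (a b : nat -> 'rV[R]_n) :
  (forall k i, a k ord0 i <= b k ord0 i) ->
  A `<=` \bigcup_k box (a k) (b k) ->
  (mu A <= \sum_(k <oo) (box_vol (a k) (b k))%:E)%E.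
Proof. by move=> ab Aab; rewrite muE; apply: ereal_inf_lbound; exists a, b. Qed.

Lemma mu_box_le (a b : 'rV[R]_n) : (forall i, a ord0 i <= b ord0 i) ->
  (mu (box a b) <= (box_vol a b)%:E)%E.
Proof.
(* Covers are sequences, so the box is padded with copies of [box a a], of volume zero because there
   is at least one side. *)
move=> ab; pose b' k := if k == 0%N then b else a.
apply: le_trans (@mu_le_cover _ (fun=> a) b' _ _) _.
- by move=> [|k] i /=.
- by move=> x xab; exists 0%N.
- rewrite nneseries_recl//; last first.
    by move=> k _; rewrite lee_fin box_vol_ge0// => i; rewrite /b'; case: ifP.
  rewrite eseries0 ?adde0// => -[//|k] _ _ /=.
  by rewrite /box_vol (bigD1 (Ordinal n_gt0))//= subrr mul0r.
Qed.

Let halfspace (i : 'I_n) (c : R) : set 'rV[R]_n := [set x | x ord0 i < c].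

(** The hyperplane cuts every box of a cover into two boxes whose volumes add up to the original
    one, so each cover of [X] splits into covers of its two pieces. *)
Lemma measurable_halfspace i c : cara (halfspace i c).
Proof.
apply: le_caratheodory_measurable => X; rewrite [leRHS]muE.
apply: le_ereal_inf_tmp => _ [a [b [ab Xab ->]]].
(* The cut is clamped to the side of the box: if the hyperplane misses the box, one piece is
   degenerate and the other is the whole box. *)
pose b' k : 'rV[R]_n := \row_j
  if j == i then Num.max (a k ord0 j) (Num.min (b k ord0 j) c) else b k ord0 j.
pose a' k : 'rV[R]_n := \row_j
  if j == i then Num.min (b k ord0 j) (Num.max (a k ord0 j) c) else a k ord0 j.
have ab' k j : a k ord0 j <= b' k ord0 j.
  by rewrite mxE; case: ifP => // _; rewrite le_max lexx.
have a'b k j : a' k ord0 j <= b k ord0 j.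
  by rewrite mxE; case: ifP => // _; rewrite ge_min lexx.
have -> : (\sum_(k <oo) (box_vol (a k) (b k))%:E =
    \sum_(k <oo) (box_vol (a k) (b' k))%:E +
    \sum_(k <oo) (box_vol (a' k) (b k))%:E)%E.
  rewrite -nneseriesD; [|by move=> *; rewrite lee_fin box_vol_ge0..].
  apply: eq_eseriesr => k _; rewrite -EFinD; congr EFin.
  pose rest := \prod_(j < n | j != i) (b k ord0 j - a k ord0 j).
  have -> : box_vol (a k) (b k) = (b k ord0 i - a k ord0 i) * rest.
    by rewrite /box_vol (bigD1 i).
  have -> : box_vol (a k) (b' k) = (b' k ord0 i - a k ord0 i) * rest.
    rewrite /box_vol (bigD1 i)//=; congr (_ * _).
    by apply: eq_bigr => j ji; rewrite mxE (negbTE ji).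
  have -> : box_vol (a' k) (b k) = (b k ord0 i - a' k ord0 i) * rest.
    rewrite /box_vol (bigD1 i)//=; congr (_ * _).
    by apply: eq_bigr => j ji; rewrite mxE (negbTE ji).
  rewrite -mulrDl; congr (_ * _); rewrite !mxE eqxx.
  have := ab k i; move: (a k ord0 i) (b k ord0 i) => u v uv.
  case: (leP v c) => vc.
    rewrite (max_idPr uv) (_ : Num.min v _ = v) ?subrr ?addr0//.
    by apply/min_idPl; rewrite le_max vc orbT.
  case: (leP u c) => uc; rewrite minElt.
    by rewrite ltNge (ltW vc)/=; ring.
  by rewrite ltNge uv/= subrr add0r.
apply: leeD; apply: mu_le_cover => // x [Xx /= xc];
  have [k _ xk] := Xab _ Xx; exists k => // j; have /andP[aj bj] := xk j.
- rewrite aj mxE/=; case: eqP => [ji|//].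
  by rewrite lt_max lt_min bj ji xc orbT.
- rewrite bj mxE andbT; case: eqP => [ji|//].
  have cx : c <= x ord0 i by rewrite leNgt; exact/negP.
  by rewrite ge_min ge_max aj/= ji cx orbT.
Qed.

Lemma measurable_coord i : measurable_fun setT (fun x : caraT => x ord0 i : R).
Proof.
apply: (measurability (@RGenCInfty.G R)) => [|/= _ [_ [c ->] <-]].
  exact: RGenCInfty.measurableE.
rewrite setTI -[X in measurable X]setCK; apply: measurableC.
rewrite [X in measurable X](_ : _ = halfspace i c); first exact: measurable_halfspace.
apply/seteqP; split=> x /=; rewrite in_itv/= andbT; first by move/negP; rewrite -ltNge.
by move=> xc; apply/negP; rewrite -ltNge.
Qed.

Lemma measurable_box (a b : 'rV[R]_n) : cara (box a b).
Proof.
rewrite [X in cara X](_ : _ = \bigcap_(i in [set: 'I_n])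
    (~` halfspace i (a ord0 i) `&` halfspace i (b ord0 i))).
  apply: fin_bigcap_measurable => [|i _]; first exact: finite_finset.
  by apply: measurableI; [apply: measurableC|]; exact: measurable_halfspace.
apply/seteqP; split=> x.
  move=> xab i _; have /andP[ax xb] := xab i.
  by split => //=; apply/negP; rewrite -leNgt.
move=> xab i; have [/= /negP ax xb] := xab i I.
by rewrite xb leNgt ax.
Qed.

(** The union of the boxes of a near-optimal cover is measurable. This supplies measurable supersets
    of the tubes at an arbitrarily small cost in measure. *)
Lemma mu_lt_measurable_cover (A : set 'rV[R]_n) (c : \bar R) : (mu A < c)%E ->
  exists U, [/\ cara U, A `<=` U & (mu U < c)%E].
Proof.
rewrite muE => /ereal_inf_lt[_ [a [b [ab Aab ->]]] abc].
exists (\bigcup_k box (a k) (b k)); split => //.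
  by apply: bigcup_measurable => k _; exact: measurable_box.
exact: le_lt_trans (mu_le_cover _ _) abc.
Qed.

(* The reflection of a half-open box is half-open on the other side; enlarging
   the image by a factor [l > 1] repairs this, since boxes with a zero side are
   empty. *)
Lemma mu_preimage_reflect_le (t : R) (x : 'rV[R]_n) (A : set 'rV[R]_n) : 0 < t ->
  (mu ((fun y => t^-1 *: (x - y)) @^-1` A) <= (t ^+ n)%:E * mu A)%E.
Proof.
move=> t0; apply/lee_mul01Pr => // r /andP[r0 r1].
(* Enlarging by [l] multiplies volumes by [l ^+ n], which has to absorb the factor [1 / r], with
   [r < 1] arbitrary. *)
pose l := powR r^-1 n%:R^-1.
have n0 : n%:R != 0 :> R by rewrite pnatr_eq0 -lt0n.
have ln : l ^+ n = r^-1.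
  by rewrite -powR_mulrn ?powR_ge0// -powRrM mulVf// powRr1// invr_ge0 ltW.
have l1 : 1 < l.
  have ni0 : 0 < n%:R^-1 :> R by rewrite invr_gt0 ltr0n.
  have := @gt0_ltr_powR R _ ni0 1 r^-1; rewrite powR1; apply.
  - by rewrite nnegrE.
  - by rewrite nnegrE invr_ge0 ltW.
  - by rewrite invf_gt1.
rewrite -lee_pdivlMl// -ln muleA -EFinM -exprMn.
have l0 : 0 < l by exact: lt_trans l1.
rewrite [X in (_ <= _ * X)%E]muE -ereal_inf_pZl ?exprn_gt0 ?mulr_gt0//.
apply: le_ereal_inf_tmp => _ [_ [a [b [ab Aab ->]]] <-].
pose a' k : 'rV[R]_n := x - t *: b k.
pose b' k : 'rV[R]_n := a' k + (l * t) *: (b k - a k).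
have ab' k i : a' k ord0 i <= b' k ord0 i.
  rewrite [leRHS]mxE lerDl !mxE; apply: mulr_ge0; first by rewrite mulr_ge0 ?ltW.
  by rewrite subr_ge0.
rewrite -nneseriesZl; last by move=> k _; rewrite lee_fin box_vol_ge0.
rewrite (_ : (\sum_(k <oo) _)%E = (\sum_(k <oo) (box_vol (a' k) (b' k))%:E)%E).
  apply: mu_le_cover => // y /= /Aab[k _ yk]; exists k => // i.
  have /andP[ay yb] := yk i; have := le_lt_trans ay yb.
  move: ay yb; rewrite !mxE; move: (a k ord0 i) (b k ord0 i) (x ord0 i) (y ord0 i).
  move=> u v c w; rewrite mulrC ler_pdivlMr// ltr_pdivrMr// => uc cv uv.
  apply/andP; split.
    by rewrite lerBlDr -lerBlDl mulrC ltW.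
  apply: (@le_lt_trans _ _ (c - u * t)); first by rewrite lerBrDr -lerBrDl.
  rewrite -subr_gt0.
  have -> : c - t * v + l * t * (v - u) - (c - u * t) = (l - 1) * (t * (v - u)).
    by ring.
  by rewrite !mulr_gt0// subr_gt0.
apply: eq_eseriesr => k _; rewrite -EFinM; congr EFin.
rewrite /box_vol -[X in _ ^+ X]card_ord -prodr_const -big_split/=.
by apply: eq_bigr => i _; rewrite !mxE; ring.
Qed.

(** The inverse map [z |-> x - t *: z] has the same form, with [t^-1] and [t^-1 *: x] as parameters;
    the inequality for it is the missing direction. *)
Lemma mu_preimage_reflect (t : R) (x : 'rV[R]_n) (A : set 'rV[R]_n) : 0 < t ->
  mu ((fun y => t^-1 *: (x - y)) @^-1` A) = ((t ^+ n)%:E * mu A)%E.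
Proof.
move=> t0; apply/eqP; rewrite eq_le mu_preimage_reflect_le//=.
have ti0 : 0 < t^-1 by rewrite invr_gt0.
rewrite -lee_pdivlMl ?exprn_gt0// -exprVn.
apply: le_trans (mu_preimage_reflect_le (t^-1 *: x) _ ti0).
apply: le_outer_measure => z Az /=.
rewrite invrK (scalerBr t) scalerA divff ?gt_eqF// scale1r opprB addrC subrK.
by rewrite scalerA mulVf ?gt_eqF// scale1r.
Qed.

Lemma measurable_reflect (t : R) (x : 'rV[R]_n) : 0 < t ->
  measurable_fun setT (fun y : caraT => t^-1 *: (x - y) : caraT).
Proof.
move=> t0 _ A mA; rewrite setTI; apply: le_caratheodory_measurable => X.
set phi := fun y => _.
have phiK y : t^-1 *: (x - (x - t *: y)) = y.
  by rewrite opprB addrC subrK scalerA mulVf ?gt_eqF// scale1r.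
have phiK' y : x - t *: (t^-1 *: (x - y)) = y.
  by rewrite scalerA divff ?gt_eqF// scale1r opprB addrC subrK.
pose Y : set 'rV[R]_n := (fun y => x - t *: y) @^-1` X.
have -> : X = phi @^-1` Y by apply/seteqP; split=> y; rewrite /Y/= /phi phiK'.
rewrite preimage_setC -!preimage_setI !mu_preimage_reflect//.
rewrite -ge0_muleDr//; apply: lee_wpmul2l; first by rewrite lee_fin exprn_ge0// ltW.
by rewrite -(mA Y).
Qed.

(** Change of variables: the pushforward of [mu] under the reflection is [t ^+ n] times [mu]. *)
Lemma integral_reflect (t : R) (x : 'rV[R]_n) (f : caraT -> \bar R) : 0 < t ->
  measurable_fun setT f -> (forall z, 0 <= f z)%E ->
  (\int[mu : set caraT -> \bar R]_y f (t^-1 *: (x - y)) =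
   (t ^+ n)%:E * \int[mu : set caraT -> \bar R]_z f z)%E.
Proof.
move=> t0 mf f0; have mphi := measurable_reflect x t0.
have tn0 : 0 <= t ^+ n by rewrite exprn_ge0// ltW.
have := @ge0_integral_pushforward _ _ caraT caraT R _ mphi mu setT f measurableT mf.
rewrite preimage_setT => <-; last by move=> z _; exact: f0.
rewrite -(ge0_integral_mscale mu measurableT (NngNum tn0) mf)//.
apply: eq_measure_integral => A mA _ /=.
by rewrite /pushforward/= mu_preimage_reflect.
Qed.
End lebesgue_outer_measure.

(** * Upper and lower limits along a proper filter *)

Section limf.
Variables (R : realType) (F : set_system R) (FF : ProperFilter F).
Variable f : R -> \bar R.

Lemma limf_esup_lt (c : \bar R) : (limf_esup f F < c)%E ->
  \forall x \near F, (f x < c)%E.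
Proof.
rewrite limf_esupE => /ereal_inf_lt[_ [V FV <-] fVc].
apply: filterS FV => x Vx; apply: le_lt_trans fVc.
by apply: ereal_sup_ubound; exists x.
Qed.

Lemma limf_esup_le (c : \bar R) : (\forall x \near F, (f x <= c)%E) ->
  (limf_esup f F <= c)%E.
Proof.
move=> FV; rewrite limf_esupE.
apply: (@le_trans _ _ (ereal_sup (f @` [set x | (f x <= c)%E]))).
  by apply: ereal_inf_lbound; exists [set x | (f x <= c)%E].
by apply: ge_ereal_sup => _ [x /= fx <-].
Qed.

Lemma limf_einf_gt (c : \bar R) : (c < limf_einf f F)%E ->
  \forall x \near F, (c < f x)%E.
Proof.
rewrite limf_einfE => /ereal_sup_gt[_ [V FV <-] fVc].
apply: filterS FV => x Vx; apply: lt_le_trans fVc _.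
by apply: ereal_inf_lbound; exists x.
Qed.

Lemma limf_einf_ge (c : \bar R) : (\forall x \near F, (c <= f x)%E) ->
  (c <= limf_einf f F)%E.
Proof.
move=> FV; rewrite limf_einfE.
apply: (@le_trans _ _ (ereal_inf (f @` [set x | (c <= f x)%E]))).
  by apply: le_ereal_inf_tmp => _ [x /= fx <-].
by apply: ereal_sup_ubound; exists [set x | (c <= f x)%E].
Qed.

Lemma limf_einf_le_esup : (limf_einf f F <= limf_esup f F)%E.
Proof.
rewrite limf_einfE limf_esupE.
apply: ge_ereal_sup => _ [V FV <-]; apply: le_ereal_inf_tmp => _ [W FW <-].
have [x [Vx Wx]] := filter_ex (filterI FV FW).
by apply: (@le_trans _ _ (f x)); [apply: ereal_inf_lbound|apply: ereal_sup_ubound];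
  exists x.
Qed.

End limf.

(** * The Euclidean norm, and segments crossing the boundary *)

Section enorm.
Variables (R : realType) (n : nat).
Implicit Types x y : 'rV[R]_n.

Lemma enorm_ge0 x : 0 <= enorm x. Proof. exact: sqrtr_ge0. Qed.

Lemma enormZ (a : R) x : enorm (a *: x) = `|a| * enorm x.
Proof.
rewrite /enorm (eq_bigr (fun i => a ^+ 2 * x ord0 i ^+ 2)); last first.
  by move=> i _; rewrite mxE exprMn.
by rewrite -mulr_sumr sqrtrM ?sqr_ge0// sqrtr_sqr.
Qed.

Lemma enormN x : enorm (- x) = enorm x.
Proof. by rewrite -scaleN1r enormZ normrN1 mul1r. Qed.

Lemma coord_le_enorm x i : `|x ord0 i| <= enorm x.
Proof.
rewrite -sqrtr_sqr ler_wsqrtr// (bigD1 i)//= lerDl sumr_ge0// => j _.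
exact: sqr_ge0.
Qed.

(** Crude comparison with the sup norm: a sum of [n] squares is at most [n * m ^+ 2], hence at most
    [(n * m) ^+ 2]. *)
Lemma enorm_le_coord x (m : R) : (forall i, `|x ord0 i| <= m) ->
  enorm x <= n%:R * m.
Proof.
case: (posnP n) => [n0 _|n0 xm].
  rewrite /enorm big1 ?sqrtr0 ?n0 ?mul0r// => i; exfalso.
  by case: i => i; rewrite n0.
have m0 : 0 <= m by exact: le_trans (normr_ge0 _) (xm (Ordinal n0)).
have nm0 : 0 <= n%:R * m by rewrite mulr_ge0.
rewrite -(ger0_norm nm0) -sqrtr_sqr ler_wsqrtr// exprMn.
apply: (@le_trans _ _ (n%:R * m ^+ 2)).
  rewrite mulr_natl -[X in _ *+ X]card_ord -sumr_const.
  apply: ler_sum => i _; rewrite -real_normK ?num_real//.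
  by rewrite lerXn2r// nnegrE.
by rewrite ler_wpM2r ?sqr_ge0// -natrX ler_nat -{1}(expn1 n) leq_pexp2l.
Qed.

(** The crossing parameter is the supremum [s] of those whose point lies in [A]. Points of [A]
    accumulate at [g s], and an interior point would allow a larger parameter or put [y] in [A]. *)
Lemma boundary_segment (A : set 'rV[R]_n) x y : A x -> ~ A y ->
  exists2 s : R, 0 <= s <= 1 & boundary A (x + s *: (y - x)).
Proof.
move=> Ax nAy; pose g (s : R) := x + s *: (y - x).
pose S := [set s : R | 0 <= s <= 1 /\ A (g s)].
have S0 : S 0 by split; [rewrite lexx ler01|rewrite /g scale0r addr0].
have supS : has_sup S by split; [exists 0|exists 1 => s [/andP[]]].
pose s := sup S.
have s0 : 0 <= s by exact: ub_le_sup supS.2 _ S0.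
have s1 : s <= 1 by apply: ge_sup; [exists 0|move=> u [/andP[]]].
have cg u : {for u, continuous g}.
  apply: continuousD; first exact: cst_continuous.
  by apply: continuousZl => //; exact: cvg_id.
exists s; first by rewrite s0.
split.
  move=> B /(cg s)[e /= e0 eB].
  have [u Su su] := sup_adherent e0 supS.
  exists (g u); split; first by case: Su.
  apply: eB => /=; have us : u <= s by exact: ub_le_sup supS.2 _ Su.
  by rewrite ger0_norm ?subr_ge0// ltrBlDl -ltrBlDr.
move=> /(cg s)[e /= e0 eA].
have [s1'|s1'] := ltP s 1; last first.
  have s1E : s = 1 by apply/eqP; rewrite eq_le s1.
  apply: nAy; have := eA 1; rewrite s1E /= subrr normr0 => /(_ e0).
  by rewrite /g scale1r addrC subrK.
(* A parameter beyond [s], still within [e] of it and capped at 1 to stay on the segment. *)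
pose u := Num.min 1 (s + e / 2).
have su : s < u by rewrite lt_min s1' ltrDl divr_gt0.
have : u <= s.
  apply: ub_le_sup supS.2 _ _; split.
    by rewrite (le_trans s0 (ltW su)) ge_min lexx.
  apply: eA => /=; rewrite distrC ger0_norm ?subr_ge0 1?ltW//.
  rewrite ltrBlDl gt_min ltrD2l; apply/orP; right.
  by rewrite ltr_pdivrMr// ltr_pMr// ltr1n.
by rewrite leNgt su.
Qed.

(** The crossing point lies on the segment, so it is no farther from [x] than [y] is. *)
Lemma boundary_tube (A : set 'rV[R]_n) x y (r : R) : A x -> ~ A y ->
  enorm (x - y) < r -> tube (boundary A) r x.
Proof.
move=> Ax nAy xyr; have [s /andP[s0 s1] bs] := boundary_segment Ax nAy.
exists (x + s *: (y - x)) => //.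
rewrite opprD addrA subrr add0r enormN enormZ ger0_norm//.
apply: le_lt_trans xyr; rewrite -[in leRHS]opprB enormN.
by rewrite ler_piMl// enorm_ge0.
Qed.

End enorm.

(** * Measurability of the norm, measures of bounded sets and of cubes *)

Section enorm_measure.
Variables (R : realType) (n : nat).
Hypothesis n_gt0 : (0 < n)%N.
Variable mu : {outer_measure set 'rV[R]_n -> \bar R}.
Hypothesis muE : forall A, mu A = lebesgue_outer A.

Let caraT := caratheodory_type mu.

Lemma measurable_enorm : measurable_fun setT (fun x : caraT => enorm x : R).
Proof.
rewrite (_ : (fun _ => _) =
    @Num.sqrt R \o (fun x : caraT => \sum_(i < n) x ord0 i ^+ 2))//.
apply: measurableT_comp.
  by apply: continuous_measurable_fun; exact: sqrt_continuous.
by apply: measurable_sum => i; apply: measurable_funX; exact: measurable_coord.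
Qed.

Lemma bounded_in_box (A : set 'rV[R]_n) : bounded_set A ->
  exists M : R, 0 < M /\ A `<=` box (const_mx (- M)) (const_mx M).
Proof.
(* [bounded_set] gives a bound for each number above [M], hence [M + 1]; a further 1 is added below
   because boxes are open on the upper side. *)
move=> [M [_ MA]]; pose M' := Num.max 1 (M + 1).
exists (M' + 1); split; first by rewrite ltr_wpDl// le_max ler01.
move=> x Ax i; rewrite !mxE.
have MM' : M < M' by rewrite lt_max ltrDl ltr01 orbT.
have xM : `|x ord0 i| <= M'.
  apply: le_trans (MA M' MM' x Ax).
  rewrite {2}/Num.norm/= mx_normrE.
  exact: (le_bigmax _ (fun ij => `|x ij.1 ij.2|) (ord0, i)).
by move: xM; rewrite ler_norml => /andP[]; lra.
Qed.

Lemma mu_bounded_lty (A : set 'rV[R]_n) : bounded_set A -> (mu A < +oo)%E.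
Proof.
move=> /bounded_in_box[M [M0 AM]].
apply: le_lt_trans (le_outer_measure mu _ _ AM) _.
apply: le_lt_trans (mu_box_le n_gt0 muE _) _; last exact: ltry.
by move=> i; rewrite !mxE; lra.
Qed.

(** Half-open ball of the sup norm; as a box it is measurable with a known bound on its measure. *)
Definition cube (x : 'rV[R]_n) (r : R) : set 'rV[R]_n :=
  box (x - const_mx r) (x + const_mx r).

Lemma mu_cube_le (x : 'rV[R]_n) (r : R) : 0 <= r ->
  (mu (cube x r) <= ((2 * r) ^+ n)%:E)%E.
Proof.
move=> r0; apply: le_trans (mu_box_le n_gt0 muE _) _.
  by move=> i; rewrite !mxE; lra.
rewrite lee_fin /box_vol (eq_bigr (fun=> 2 * r)).
  by rewrite prodr_const card_ord.
by move=> i _; rewrite !mxE; ring.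
Qed.

Lemma eball_sub_cube (x : 'rV[R]_n) (r : R) :
  eball x r `<=` cube x r.
Proof.
move=> y /= yr i; have := le_lt_trans (coord_le_enorm _ i) yr.
rewrite !mxE ltr_norml => /andP[]; lra.
Qed.

End enorm_measure.

(** * Right neighbourhoods of zero, and the lower bound by packing *)

Lemma near_right0P (R : realType) (P : R -> Prop) :
  (\forall t \near 0^'+, P t) <->
  exists2 e : R, 0 < e & forall t, 0 < t < e -> P t.
Proof.
split=> [[e /= e0 eP]|[e e0 eP]].
  exists e => // t /andP[t0 te]; apply: eP => //=.
  by rewrite sub0r normrN gtr0_norm.
exists e => //= t /=; rewrite sub0r normrN => te t0; apply: eP.
by rewrite t0 -(gtr0_norm t0).
Qed.

(** By disjointness at most one indicator of the [C i] is nonzero at each point, so [g] dominates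
    [K] times their sum, which is integrated term by term. *)
Lemma packing_integral_ge (d : measure_display) (T : measurableType d)
    (R : realType) (mu : {measure set T -> \bar R}) (N : nat)
    (C : nat -> set T) (D : set T) (g : T -> \bar R) (K m : R) :
  (forall i, measurable (C i)) -> measurable D ->
  (forall i j, (i < N)%N -> (j < N)%N -> i != j -> C i `&` C j = set0) ->
  0 <= K -> 0 <= m ->
  (forall x, D x -> 0 <= g x)%E ->
  (forall i x, (i < N)%N -> D x -> C i x -> K%:E <= g x)%E ->
  (forall i, (i < N)%N -> m%:E <= mu (C i `&` D))%E ->
  ((N%:R * (K * m))%:E <= \int[mu]_(x in D) g x)%E.
Proof.
move=> mC mD dC K0 m0 g0 Kg mmu.
pose h (i : 'I_N) (x : T) := (K%:E * (\1_(C i) x)%:E)%E.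
have h0 i x : (0 <= h i x)%E by rewrite mule_ge0// lee_fin.
apply: (@le_trans _ _ (\int[mu]_(x in D) \sum_(i < N) h i x)%E); last first.
  apply: ge0_le_lower_integral => [x _|x Dx]; first exact: sume_ge0.
  have [[i Cix]|nC] := pselect (exists i : 'I_N, C i x).
    rewrite (bigD1 i)//= big1 ?adde0.
      by rewrite /h indicE mem_set// mule1; exact: (Kg i).
    move=> j ji; rewrite /h indicE memNset ?mule0// => Cjx.
    have : (C j `&` C i) x by [].
    by rewrite dC.
  rewrite big1 ?g0// => i _; rewrite /h indicE memNset ?mule0// => Cix.
  by apply: nC; exists i.
rewrite ge0_integral_sum//; last first.
  move=> i; apply: emeasurable_funM => //.
  by apply/measurable_EFinP; exact: measurable_indic.
apply: (@le_trans _ _ (\sum_(i < N) (K * m)%:E)%E).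
  by rewrite sumEFin sumr_const card_ord mulr_natl.
apply: lee_sum => i _; rewrite ge0_integralZl_EFin//; last first.
  by apply/measurable_EFinP; exact: measurable_indic.
rewrite integral_indic// EFinM; apply: lee_wpmul2l; first by rewrite lee_fin.
exact: mmu.
Qed.

Section lower_bound.
Variables (R : realType) (n : nat).
Hypothesis n_gt0 : (0 < n)%N.
Variable mu : {outer_measure set 'rV[R]_n -> \bar R}.
Hypothesis muE : forall A, mu A = lebesgue_outer A.

Let caraT := caratheodory_type mu.
Let cara : set (set caraT) := measurable.

Variables (Omega : set 'rV[R]_n) (D r : R).
Hypothesis bOmega : bounded_set Omega.
Hypothesis mOmega : cara Omega.
Hypothesis D_gt0 : 0 < D.
Hypothesis r_gt0 : 0 < r.
Hypothesis density : forall x, boundary Omega x ->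
  ((D * r ^+ n)%:E <= mu (eball x r `&` Omega))%E /\
  ((D * r ^+ n)%:E <= mu (eball x r `&` ~` Omega))%E.

(** The family is a total function of which only the first [N] values matter, so adding a point
    keeps its type. *)
Definition separated (N : nat) (p : nat -> 'rV[R]_n) :=
  (forall i, (i < N)%N -> boundary Omega (p i)) /\
  (forall i j, (i < N)%N -> (j < N)%N -> i != j ->
    exists k, 2 * r <= `|p i ord0 k - p j ord0 k|).

Let Drn_gt0 : 0 < D * r ^+ n.
Proof. by rewrite mulr_gt0// exprn_gt0. Qed.

(** A common point would put the two centres at distance below [2 * r] in every coordinate, strictly
    because the cubes are half-open. *)
Lemma separated_disjoint N p : separated N p -> forall i j,
  (i < N)%N -> (j < N)%N -> i != j -> cube (p i) r `&` cube (p j) r = set0.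
Proof.
move=> [_ sep] i j iN jN ij; apply/seteqP; split => // x [xi xj].
have [k] := sep i j iN jN ij.
have := xi k; have := xj k; rewrite !mxE => /andP[? ?] /andP[? ?].
by rewrite leNgt ltr_norml => /negP; apply; apply/andP; split; lra.
Qed.

(** Each cube contains the Euclidean ball to which the density bound applies. The lemma serves
    twice: with [g = 1] to bound [N], and with the inner integral of [Jt]. *)
Lemma separated_integral_ge N p (g : caraT -> \bar R) (A : set 'rV[R]_n) (K : R) :
  separated N p -> cara A ->
  (forall x, boundary Omega x -> (D * r ^+ n)%:E <= mu (eball x r `&` A))%E ->
  0 <= K -> (forall x, A x -> 0 <= g x)%E ->
  (forall i x, (i < N)%N -> A x -> cube (p i) r x -> K%:E <= g x)%E ->
  ((N%:R * (K * (D * r ^+ n)))%:E <=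
    \int[mu : set caraT -> \bar R]_(x in A) g x)%E.
Proof.
move=> sep mA dA K0 g0 Kg.
apply: (@packing_integral_ge _ caraT R mu N (fun i => cube (p i) r)) => //.
- by move=> i; exact: measurable_box.
- exact: separated_disjoint.
- exact: ltW.
- move=> i iN; apply: le_trans (dA _ (sep.1 i iN)) _.
  by apply: le_outer_measure; apply: setSI; exact: eball_sub_cube.
Qed.

(** Disjoint cubes each take at least [D * r ^+ n] of the finite measure of [Omega]. *)
Lemma separated_bounded : exists B : nat, forall N p, separated N p -> (N <= B)%N.
Proof.
have muOmega : (mu Omega < +oo)%E := mu_bounded_lty n_gt0 muE bOmega.
have muOmega_fin : mu Omega \is a fin_num by rewrite ge0_fin_numE.
exists (Num.truncn (fine (mu Omega) / (D * r ^+ n))) => N p sep.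
have q0 : 0 <= fine (mu Omega) / (D * r ^+ n).
  by rewrite divr_ge0 ?fine_ge0// ltW.
rewrite truncn_ge_nat// ler_pdivlMr// -lee_fin fineK//.
have := @separated_integral_ge N p (cst 1%E) Omega 1 sep mOmega
  (fun x bx => (density bx).1) ler01 (fun _ _ => lee01) (fun _ _ _ _ _ => lexx _).
by rewrite mul1r integral_cst// mul1e.
Qed.

(** If every separated family left some boundary point far from all its members, that point could be
    added, giving families of every size and contradicting [separated_bounded]. *)
Lemma maximal_separated : exists N p, separated N p /\
  forall x, boundary Omega x -> exists2 i, (i < N)%N &
    forall k, `|x ord0 k - p i ord0 k| < 2 * r.
Proof.
have [B NB] := separated_bounded; apply: contrapT => nmax.
suff sepN N : exists p, separated N p.
  by have [p /NB] := sepN B.+1; rewrite ltnn.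
elim: N => [|N [p sep]]; first by exists (fun=> 0); split.
apply: contrapT => nsep; apply: nmax; exists N, p; split=> // x bx.
apply: contrapT => far; apply: nsep.
have farx i : (i < N)%N -> exists k, 2 * r <= `|x ord0 k - p i ord0 k|.
  move=> iN; apply: contrapT => nk; apply: far; exists i => // k.
  by rewrite ltNge; apply/negP => xk; apply: nk; exists k.
exists (fun i => if (i < N)%N then p i else x); split.
  by move=> i _; case: ifPn => // iN; exact: sep.1.
move=> i j; rewrite (ltnS i) (ltnS j) (leq_eqVlt i) (leq_eqVlt j).
move=> /predU1P[->|iN] /predU1P[->|jN] ij.
- by rewrite eqxx in ij.
- by rewrite ltnn jN; exact: farx.
- by rewrite ltnn iN; have [k xk] := farx i iN; exists k; rewrite distrC.
- by rewrite iN jN; exact: sep.2.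
Qed.

Lemma Jt_ge (J : 'rV[R]_n -> R) (cJ aJ t m : R) :
  0 < t -> 0 < cJ -> (forall z, 0 <= J z) ->
  (forall z, enorm z <= aJ -> cJ <= J z) ->
  n%:R * (2 * r) <= aJ * t ->
  (m%:E <= mu (tube (boundary Omega) r))%E ->
  ((m * (cJ * D ^+ 2 * r ^+ n / 6 ^+ n))%:E <= Jt mu J Omega t)%E.
Proof.
move=> t0 cJ0 J0 JcJ rt mtube.
have [N [p [sep cov]]] := maximal_separated.
(* A point of the tube is within [r] of a boundary point, itself within [2 * r] of some [p i] in
   each coordinate: cubes of half-side [3 * r] cover. *)
have mN : m <= N%:R * (2 * (3 * r)) ^+ n.
  rewrite -lee_fin; apply: le_trans mtube _.
  apply: (@le_trans _ _ (mu (\big[setU/set0]_(i < N) cube (p i) (3 * r)))).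
    apply: le_outer_measure => x [b bb xb].
    have [i iN bi] := cov b bb.
    rewrite -(bigcup_mkord N (fun i => cube (p i) (3 * r))); exists i => // k.
    have := le_lt_trans (coord_le_enorm _ k) xb; have := bi k.
    by rewrite !mxE !ltr_norml => /andP[? ?] /andP[? ?]; apply/andP; split; lra.
  apply: le_trans (outer_measure_subadditive mu (fun i => cube (p i) (3 * r)) N) _.
  apply: (@le_trans _ _ (\sum_(i < N) ((2 * (3 * r)) ^+ n)%:E)%E).
    by apply: lee_sum => i _; apply: mu_cube_le => //; rewrite mulr_ge0// ltW.
  by rewrite sumEFin sumr_const card_ord lee_fin -[leLHS]mulr_natl.
(* [K] bounds the inner integral below for [x] in a cube: there [J] is at least [cJ] for [y] in the
   part of the same cube outside [Omega]. *)
pose K := cJ * (D * r ^+ n).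
apply: (@le_trans _ _ (N%:R * (K * (D * r ^+ n)))%:E).
  rewrite lee_fin.
  apply: le_trans (ler_wpM2r _ mN) _.
    by rewrite divr_ge0 ?exprn_ge0// mulr_ge0 ?mulr_ge0 ?exprn_ge0// ltW.
  rewrite le_eqVlt; apply/orP; left; apply/eqP; rewrite /K mulrA -natrM exprMn.
  by field; rewrite expf_neq0.
rewrite /Jt; apply: (separated_integral_ge sep) => //.
- by move=> x /density[].
- by rewrite /K mulr_ge0 ?ltW.
- by move=> x _; apply: integral_ge0 => y _; rewrite lee_fin.
move=> i x iN Ox xi.
have mC : cara (~` Omega) by exact: measurableC.
apply: (@le_trans _ _ (\int[mu : set caraT -> \bar R]_(y in ~` Omega)
    (cJ%:E * (\1_(cube (p i) r) y)%:E))%E); last first.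
  apply: ge0_le_lower_integral => y Oy; first by rewrite mule_ge0// lee_fin ltW.
  rewrite indicE; case: (pselect (cube (p i) r y)) => yi; last first.
    by rewrite memNset// mule0 lee_fin.
  rewrite mem_set// mule1 lee_fin; apply: JcJ.
  rewrite enormZ gtr0_norm ?invr_gt0// mulrC ler_pdivrMr//.
  (* Two points of one cube differ by less than [2 * r] in each coordinate. *)
  apply: le_trans rt; apply: enorm_le_coord => k.
  have := xi k; have := yi k; rewrite !mxE => /andP[? ?] /andP[? ?].
  by rewrite ler_norml; apply/andP; split; lra.
have mc : cara (cube (p i) r) by exact: measurable_box.
rewrite ge0_integralZl_EFin//; last 2 first.
- by apply/measurable_EFinP; exact: measurable_indic.
- exact: ltW.
rewrite integral_indic// /K EFinM; apply: lee_wpmul2l; first by rewrite lee_fin ltW.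
apply: le_trans (density (sep.1 i iN)).2 _.
by apply: le_outer_measure; apply: setSI; exact: eball_sub_cube.
Qed.

End lower_bound.

(** * Upper bound by summation over dyadic shells *)

Definition dyadic_shell {R : realType} {n : nat} (k : nat) : set 'rV[R]_n :=
  [set z | (if k is j.+1 then 2 ^+ j else 0) <= enorm z < 2 ^+ k].

Section upper_bound.
Variables (R : realType) (n : nat).
Hypothesis n_gt0 : (0 < n)%N.
Variable mu : {outer_measure set 'rV[R]_n -> \bar R}.
Hypothesis muE : forall A, mu A = lebesgue_outer A.

Let caraT := caratheodory_type mu.
Let cara : set (set caraT) := measurable.
Let leb : {measure set caraT -> \bar R} := mu.

Let shell (k : nat) : set caraT := @dyadic_shell R n k.

Lemma measurable_shell k : measurable (shell k).
Proof.
have := @measurable_enorm R n mu muE measurableT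
  `[(if k is j.+1 then 2 ^+ j else 0), (2 ^+ k)[%classic (measurable_itv _).
rewrite setTI; by congr measurable; apply/seteqP; split=> z /=; rewrite in_itv.
Qed.

(** Shell 0 is the whole open unit ball and not an annulus, so the origin is covered too. *)
Lemma shell_ex z : exists k, shell k z.
Proof.
have [k zk] : exists k, enorm z < 2 ^+ k.
  exists (Num.truncn (enorm z)).+1; apply: lt_le_trans (truncnS_gt _) _.
  by rewrite -natrX ler_nat ltnW// ltn_expl.
elim: k zk => [|k IH] zk; first by exists 0%N; rewrite /shell /dyadic_shell/= enorm_ge0.
case: (ltP (enorm z) (2 ^+ k)) => [/IH//|kz].
by exists k.+1; rewrite /shell /dyadic_shell/= kz.
Qed.

Lemma shell_inj z j k : shell j z -> shell k z -> j = k.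
Proof.
wlog jk : j k / (j < k)%N.
  by move=> h zj zk; case: (ltngtP j k) => // jk; [|symmetry]; exact: h.
case: k jk => // k jk /andP[_ zj] /andP[kz _].
have jk2 : 2 ^+ j <= 2 ^+ k :> R by rewrite ler_weXn2l// ler1n.
by have := lt_le_trans (le_lt_trans kz zj) jk2; rewrite ltxx.
Qed.

Let on_shell (f : caraT -> R) k (z : caraT) : \bar R := (f z * \1_(shell k) z)%:E.

Lemma measurable_on_shell f k : measurable_fun setT f ->
  measurable_fun setT (on_shell f k).
Proof.
move=> mf; apply/measurable_EFinP; apply: measurable_funM => //.
exact: measurable_indic (measurable_shell k).
Qed.

Lemma on_shell_ge0 (f : caraT -> R) k : (forall z, 0 <= f z) ->
  forall z, (0 <= on_shell f k z)%E.
Proof. by move=> f0 z; rewrite lee_fin mulr_ge0. Qed.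

(** The shells partition the space, so at each point the series has one term that can be nonzero. *)
Lemma integral_shells (f : caraT -> R) :
  measurable_fun setT f -> (forall z, 0 <= f z) ->
  (\sum_(k <oo) \int[leb]_z on_shell f k z = \int[leb]_z (f z)%:E)%E.
Proof.
move=> mf f0; rewrite -integral_nneseries//; last 2 first.
- by move=> k; exact: measurable_on_shell.
- by move=> k z _; exact: on_shell_ge0.
apply: eq_integral => z _; have [k zk] := shell_ex z.
rewrite (@nneseriesD1 _ _ k)//; last by move=> j _; exact: on_shell_ge0.
rewrite /on_shell indicE mem_set// mulr1 eseries0 ?adde0// => j _ /= jk.
rewrite indicE memNset ?mulr0// => zj; move/eqP : jk; apply.
exact: shell_inj zj zk.
Qed.

Variables (Omega : set 'rV[R]_n) (J : 'rV[R]_n -> R).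
Hypothesis mOmega : cara Omega.
Hypothesis J_ge0 : forall z, 0 <= J z.
Hypothesis mJ : measurable_fun setT (J : caraT -> R).

Let shell_mass k := (\int[leb]_z on_shell J k z)%E.

Let shell_mass_ge0 k : (0 <= shell_mass k)%E.
Proof. by apply: integral_ge0 => z _; exact: on_shell_ge0. Qed.

(** If [z = (x - y) / t] lies in shell [k], then [x] lies in the tube of radius [t * 2 ^+ k], hence
    in [U k]. So [J z] is at most the [k]-th term of [F z], and the substitution integrates [F] over
    the whole space. *)
Lemma inner_integral_le (t : R) (U : nat -> set 'rV[R]_n) x : 0 < t -> Omega x ->
  (forall k, tube (boundary Omega) (t * 2 ^+ k) `<=` U k) ->
  (\int[leb]_(y in ~` Omega) (J (t^-1 *: (x - y)))%:E <=
   (t ^+ n)%:E * \sum_(k <oo) (shell_mass k * (\1_(U k) x)%:E))%E.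
Proof.
move=> t0 Ox tU.
pose f k z := ((\1_(U k) x)%:E * on_shell J k z)%E.
have f0 k z : (0 <= f k z)%E.
  by apply: mule_ge0; [rewrite lee_fin|exact: on_shell_ge0].
have mf k : measurable_fun setT (f k).
  by apply: emeasurable_funM => //; exact: measurable_on_shell.
pose F z := (\sum_(k <oo) f k z)%E.
have F0 z : (0 <= F z)%E by apply: nneseries_ge0.
have mF : measurable_fun setT F by apply: ge0_emeasurable_sum => //.
apply: (@le_trans _ _ (\int[leb]_y F (t^-1 *: (x - y)))%E).
  rewrite integral_mkcond; apply: ge0_le_lower_integral => y _.
    by rewrite /patch; case: ifP => // _; rewrite lee_fin.
  rewrite /patch; case: ifPn => [|_]; last exact: F0.
  rewrite inE => nOy; set z := t^-1 *: _.
  have [k zk] := shell_ex z.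
  apply: (@le_trans _ _ (f k z)).
    rewrite /f /on_shell !indicE (mem_set zk) mem_set ?mul1e ?mulr1//.
    apply: tU; apply: (boundary_tube Ox nOy).
    move: zk => /andP[_]; rewrite /z enormZ gtr0_norm ?invr_gt0//.
    by rewrite mulrC ltr_pdivrMr// mulrC.
  rewrite /F (@nneseriesD1 _ _ k)// leeDl// nneseries_ge0//.
rewrite (integral_reflect n_gt0 muE)//; apply: lee_wpmul2l.
  by rewrite lee_fin exprn_ge0// ltW.
rewrite /F integral_nneseries//; apply: lee_nneseries => [k _ _|k _].
  by apply: integral_ge0.
rewrite /f ge0_integralZl//; last 2 first.
- exact: measurable_on_shell.
- by move=> z _; exact: on_shell_ge0.
by rewrite muleC.
Qed.

(** Integrating the preceding bound in [x] only exchanges a series with an integral; measurability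
    of the [U k] makes this legitimate. *)
Lemma Jt_le_shells (t : R) (U : nat -> set 'rV[R]_n) : 0 < t ->
  (forall k, cara (U k)) ->
  (forall k, tube (boundary Omega) (t * 2 ^+ k) `<=` U k) ->
  (Jt mu J Omega t <=
   (t ^+ n)%:E * \sum_(k <oo) (shell_mass k * mu (U k `&` Omega)))%E.
Proof.
move=> t0 mU tU; rewrite /Jt.
have tn0 : 0 <= t ^+ n by rewrite exprn_ge0// ltW.
pose f k (x : caraT) := (shell_mass k * (\1_(U k) x)%:E)%E.
have f0 k x : (0 <= f k x)%E by rewrite mule_ge0.
have mf k : measurable_fun (Omega : set caraT) (f k).
  apply: emeasurable_funM => //.
  by apply/measurable_EFinP; apply: measurable_indic; exact: mU.
apply: (@le_trans _ _ (\int[leb]_(x in Omega)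
    ((t ^+ n)%:E * \sum_(k <oo) f k x))%E).
  apply: ge0_le_lower_integral => x Ox; last exact: inner_integral_le.
  by apply: integral_ge0 => y _; rewrite lee_fin.
rewrite ge0_integralZl_EFin//; last 2 first.
- by move=> x _; exact: nneseries_ge0.
- exact: ge0_emeasurable_sum.
apply: lee_wpmul2l; first by rewrite lee_fin.
rewrite integral_nneseries//; apply: lee_nneseries => [k _ _|k _].
  by apply: integral_ge0.
rewrite /f ge0_integralZl//.
  by rewrite integral_indic//; exact: mU.
by apply/measurable_EFinP; apply: measurable_indic; exact: mU.
Qed.

(** Trades a constant weight on one shell for a function of [z], turning powers of [2 ^+ k] into
    moments of [J]. *)
Lemma shell_mass_le (k : nat) (c : R) (g : caraT -> R) : 0 <= c ->
  measurable_fun setT g -> (forall z, 0 <= g z) ->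
  (forall z, shell k z -> c * J z <= g z) ->
  (c%:E * shell_mass k <= \int[leb]_z on_shell g k z)%E.
Proof.
move=> c0 mg g0 cg; rewrite -ge0_integralZl_EFin//; last 2 first.
- by move=> z _; exact: on_shell_ge0.
- exact: measurable_on_shell.
apply: ge0_le_lower_integral => z _.
  by rewrite mule_ge0 ?lee_fin// mulr_ge0.
rewrite -EFinM lee_fin indicE; case: (pselect (shell k z)) => zk.
  by rewrite mem_set// !mulr1 cg.
by rewrite memNset// !mulr0.
Qed.

(** Outside shell 0, [2 ^+ k] is at most twice the norm of [z], and [2] to the power [b] is at most
    2; the summand 1 handles shell 0. *)
Lemma powR2X_le (k : nat) (b : R) (z : caraT) : 0 <= b <= 1 -> shell k z ->
  powR (2 ^+ k) b <= 1 + 2 * powR (enorm z) b.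
Proof.
move=> /andP[b0 b1]; case: k => [_|k /andP[kz _]].
  by rewrite expr0 powR1 lerDl mulr_ge0// powR_ge0.
rewrite exprS powRM ?exprn_ge0//; apply: le_trans (ler_wpDl _ (lexx _)) => //.
apply: ler_pM; rewrite ?powR_ge0//.
  by rewrite -[X in _ <= X](@powRr1 _ 2)//; apply: ler_powR => //; rewrite ler1n.
by apply: ge0_ler_powR; rewrite ?nnegrE ?exprn_ge0 ?enorm_ge0.
Qed.

(** Shells with [t * 2 ^+ k < delta] use the tube bound and sum to the term with [C]. On the others
    the measure is bounded by [W], and [1 <= (2 * t * enorm z / delta) ^+ n] brings in the tail
    [tau] of the [n]-th moment. *)
Lemma Jt_le (t delta M b C W tau : R) (K : nat) :
  0 < t -> 0 < delta -> t * 2 ^+ K < delta -> 0 <= b <= 1 -> 0 <= M -> 0 <= W ->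
  (forall s, 0 < s < delta ->
    (mu (tube (boundary Omega) s) < (M * powR s b)%:E)%E) ->
  (\int[leb]_z (J z * (1 + 2 * powR (enorm z) b))%:E <= C%:E)%E ->
  (\sum_(K <= k <oo)
     \int[leb]_z on_shell (fun z => J z * enorm z ^+ n)%R k z <= tau%:E)%E ->
  (mu Omega <= W%:E)%E ->
  (Jt mu J Omega t <=
    (t ^+ n * (M * powR t b * C + W * (2 * t / delta) ^+ n * tau))%:E)%E.
Proof.
move=> t0 delta0 tK b01 M0 W0 tubeM JC Jtau OW.
have tk0 k : 0 < t * 2 ^+ k by rewrite mulr_gt0// exprn_gt0.
(* Small tubes get a near-optimal measurable cover, large ones the whole space. *)
have /choice[U UP] : forall k, exists U : set 'rV[R]_n,
    [/\ cara U, tube (boundary Omega) (t * 2 ^+ k) `<=` U &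
     t * 2 ^+ k < delta -> (mu U <= (M * powR (t * 2 ^+ k) b)%:E)%E].
  move=> k; case: (ltP (t * 2 ^+ k) delta) => tkd.
    have := tubeM (t * 2 ^+ k); rewrite tk0 tkd => /(_ isT).
    by move=> /(mu_lt_measurable_cover muE)[V [mV tV /ltW]]; exists V.
  by exists setT; split => //; exact: measurableT.
apply: (le_trans (Jt_le_shells t0 (fun k => let: And3 mU _ _ := UP k in mU)
  (fun k => let: And3 _ tU _ := UP k in tU))).
rewrite EFinM; apply: lee_wpmul2l; first by rewrite lee_fin exprn_ge0// ltW.
have menorm := @measurable_enorm R n mu muE.
pose g z := J z * (1 + 2 * powR (enorm z) b).
pose h z := J z * enorm z ^+ n.
have g0 z : 0 <= g z by rewrite mulr_ge0// addr_ge0// mulr_ge0// powR_ge0.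
have h0 z : 0 <= h z by rewrite mulr_ge0// exprn_ge0// enorm_ge0.
have mg : measurable_fun setT (g : caraT -> R).
  apply: measurable_funM => //; apply: measurable_funD => //.
  apply: measurable_funM => //.
  exact: (measurableT_comp (measurable_powR b) menorm).
have mh : measurable_fun setT (h : caraT -> R).
  by apply: measurable_funM => //; exact: measurable_funX.
pose A := M * powR t b; pose B := W * (2 * t / delta) ^+ n.
have A0 : 0 <= A by rewrite mulr_ge0// powR_ge0.
have td0 : 0 <= 2 * t / delta by rewrite divr_ge0 ?mulr_ge0// ltW.
have B0 : 0 <= B by rewrite mulr_ge0// exprn_ge0.
pose G k := (\int[leb]_z on_shell g k z)%E.
pose H k := (\int[leb]_z on_shell h k z)%E.
have G0 k : (0 <= G k)%E by apply: integral_ge0 => z _; exact: on_shell_ge0.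
have H0 k : (0 <= H k)%E by apply: integral_ge0 => z _; exact: on_shell_ge0.
(* Cutting [H] off below [K] writes the tail as a series over all [k]. *)
pose H' k := if (K <= k)%N then H k else 0%E.
have H'0 k : (0 <= H' k)%E by rewrite /H'; case: ifP.
apply: (@le_trans _ _ (\sum_(k <oo) (A%:E * G k + B%:E * H' k))%E).
  apply: lee_nneseries => [k _ _|k _]; first by rewrite mule_ge0.
  have [mU tU UM] := UP k.
  case: (ltP (t * 2 ^+ k) delta) => tkd.
    apply: (@le_trans _ _ (A%:E * G k)%E); last first.
      by rewrite leeDl// mule_ge0// lee_fin.
    apply: (@le_trans _ _ (shell_mass k * (M * powR (t * 2 ^+ k) b)%:E)%E).
      apply: lee_wpmul2l => //; apply: le_trans (UM tkd).
      by apply: le_outer_measure; exact: subIsetl.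
    rewrite powRM ?exprn_ge0 ?(ltW t0)// mulrA -/A EFinM muleC -muleA.
    apply: lee_wpmul2l; first by rewrite lee_fin.
    by apply: shell_mass_le => // z zk; rewrite mulrC ler_wpM2l// powR2X_le.
  have Kk : (K < k)%N.
    rewrite ltnNge; apply/negP => kK.
    have : t * 2 ^+ k <= t * 2 ^+ K by rewrite ler_pM2l// ler_weXn2l// ler1n.
    by move=> /(le_trans tkd); rewrite leNgt tK.
  apply: (@le_trans _ _ (B%:E * H' k)%E); last first.
    by rewrite leeDr// mule_ge0// lee_fin.
  apply: (@le_trans _ _ (shell_mass k * W%:E)%E).
    apply: lee_wpmul2l => //; apply: le_trans OW.
    by apply: le_outer_measure; exact: subIsetr.
  rewrite /H' ltnW// muleC /B EFinM -muleA; apply: lee_wpmul2l; first by rewrite lee_fin.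
  rewrite muleC -lee_pdivrMr; last first.
    by rewrite exprn_gt0// divr_gt0// mulr_gt0.
  rewrite muleC; apply: shell_mass_le => //; first by rewrite invr_ge0 exprn_ge0.
  case: k tkd Kk {mU tU UM} => // k tkd _ z /andP[kz _].
  rewrite mulrC ler_wpM2l// -exprVn lerXn2r ?nnegrE ?invr_ge0 ?enorm_ge0//.
  (* With the index shifted by one, [delta <= t * 2 ^+ k.+1] gives [delta / (2 * t) <= 2 ^+ k],
     which is at most the norm of [z]. *)
  apply: le_trans kz; rewrite invf_div ler_pdivrMr ?mulr_gt0//.
  by apply: le_trans tkd _; rewrite exprS; lra.
rewrite nneseriesD; [|by move=> k _ _; rewrite mule_ge0// lee_fin..].
rewrite !nneseriesZl//; [|by move=> *..].
rewrite -/A -/B EFinD (EFinM A) (EFinM B).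
apply: leeD; apply: lee_wpmul2l; rewrite ?lee_fin//.
  by rewrite integral_shells.
by apply: le_trans Jtau; rewrite /H' -eseries_mkcond [leRHS]eseries_cond.
Qed.

Lemma shell_tail (f : caraT -> R) (tau : R) :
  measurable_fun setT f -> (forall z, 0 <= f z) ->
  (\int[leb]_z (f z)%:E < +oo)%E -> 0 < tau ->
  exists K, (\sum_(K <= k <oo) \int[leb]_z on_shell f k z <= tau%:E)%E.
Proof.
move=> mf f0 fy tau0; rewrite -integral_shells// in fy.
have fk0 k : predT k -> (0 <= \int[leb]_z on_shell f k z)%E.
  by move=> _; apply: integral_ge0 => z _; exact: on_shell_ge0.
have : \forall K \near \oo,
    (\sum_(K <= k <oo) \int[leb]_z on_shell f k z < tau%:E)%E.
  apply: (@nneseries_tail_cvg R _ predT fy fk0 [set x | (x < tau%:E)%E]).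
  apply: open_nbhs_nbhs; split; first exact: open_ereal_lt_ereal.
  by rewrite /= lte_fin.
by move=> [K _ /(_ K (leqnn _))/ltW ?]; exists K.
Qed.

(** The constant is [7 = 2 * 3 + 1]: tubes are bounded with [2 * M1], the weight
    [1 + 2 * powR (enorm z) b] integrates to at most [3 * CJ], and the far shells add [M1 * CJ]. *)
Lemma limf_esup_Jt_ratio_le (alpha M1 CJ : R) :
  n%:R - 1 <= alpha <= n%:R -> bounded_set Omega -> 0 < M1 -> 0 < CJ ->
  (upper_minkowski mu alpha (boundary Omega) <= M1%:E)%E ->
  (forall gamma, 0 <= gamma <= n%:R ->
    (\int[leb]_z (J z * powR (enorm z) gamma)%:E <= CJ%:E)%E) ->
  (limf_esup (Jt_ratio mu J Omega alpha) (0^'+) <= (7 * CJ * M1)%:E)%E.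
Proof.
move=> /andP[alpha1 alpha2] bOmega M10 CJ0 uM JCJ.
pose b := n%:R - alpha.
have b01 : 0 <= b <= 1 by apply/andP; split; rewrite /b; lra.
have n1 : 1 <= n%:R :> R by rewrite ler1n.
have menorm := @measurable_enorm R n mu muE.
pose W := fine (mu Omega).
have W0 : 0 <= W by exact: fine_ge0.
have muW : mu Omega = W%:E.
  by rewrite fineK// ge0_fin_numE//; exact: mu_bounded_lty.
(* Doubling [M1] makes the inequality strict, so it holds for all small radii. *)
have : (upper_minkowski mu alpha (boundary Omega) < (2 * M1)%:E)%E.
  by apply: le_lt_trans uM _; rewrite lte_fin; lra.
move=> /limf_esup_lt/near_right0P[delta delta0 tubeM].
pose h z := J z * enorm z ^+ n.
have h0 z : 0 <= h z by rewrite mulr_ge0// exprn_ge0// enorm_ge0.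
have mh : measurable_fun setT (h : caraT -> R).
  by apply: measurable_funM => //; exact: measurable_funX.
have hy : (\int[leb]_z (h z)%:E < +oo)%E.
  apply: le_lt_trans (ltry CJ); have := JCJ n%:R; rewrite ler0n lexx => /(_ isT).
  by under eq_integral do rewrite powR_mulrn ?enorm_ge0//.
(* Chosen so that [W * (2 / delta) ^+ n * tau <= M1 * CJ]; [W + 1] keeps the denominator
   positive. *)
pose tau := M1 * CJ / ((W + 1) * (2 / delta) ^+ n).
have c0 : 0 < (W + 1) * (2 / delta) ^+ n.
  by rewrite mulr_gt0 ?exprn_gt0 ?divr_gt0// ltr_wpDl.
have tau0 : 0 < tau by rewrite divr_gt0// mulr_gt0.
have [K tailK] := shell_tail mh h0 hy tau0.
have JC : (\int[leb]_z (J z * (1 + 2 * powR (enorm z) b))%:E <= (3 * CJ)%:E)%E.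
  have mJb : measurable_fun setT (fun z : caraT => J z * powR (enorm z) b).
    apply: measurable_funM => //.
    exact: (measurableT_comp (measurable_powR b) menorm).
  have Jb0 z : 0 <= J z * powR (enorm z) b by rewrite mulr_ge0// powR_ge0.
  rewrite (_ : (fun z => _) = (fun z =>
    (J z)%:E + 2%:E * (J z * powR (enorm z) b)%:E)%E); last first.
    by apply/funext => z; rewrite -EFinM -EFinD; congr EFin; ring.
  rewrite ge0_integralD//; last 4 first.
  - by move=> z _; rewrite lee_fin.
  - exact/measurable_EFinP.
  - by move=> z _; rewrite mule_ge0// lee_fin.
  - by apply: emeasurable_funM => //; exact/measurable_EFinP.
  rewrite ge0_integralZl_EFin//; last 2 first.
  - by move=> z _; rewrite lee_fin.
  - exact/measurable_EFinP.
  rewrite (_ : 3 * CJ = CJ + 2 * CJ); last by ring.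
  rewrite (EFinD CJ) (EFinM 2); apply: leeD.
    have := JCJ 0; rewrite lexx ler0n => /(_ isT).
    apply: le_trans; apply: ge0_le_lower_integral => z _; rewrite lee_fin//.
    by rewrite powRr0 mulr1.
  apply: lee_wpmul2l => //; apply: JCJ; case/andP: b01 => -> /= b1.
  exact: le_trans b1 n1.
apply: limf_esup_le; apply/near_right0P.
have K0 : 0 < 2 ^+ K :> R by rewrite exprn_gt0.
(* The bound 1 gives [t ^+ n <= powR t b], as [b <= 1 <= n]; the other gives
   [t * 2 ^+ K < delta]. *)
exists (Num.min 1 (delta / 2 ^+ K)); first by rewrite lt_min ltr01 divr_gt0.
move=> t /andP[t0]; rewrite lt_min => /andP[t1]; rewrite ltr_pdivlMr// => tK.
rewrite /Jt_ratio lee_pdivrMr ?powR_gt0//.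
have tb0 : 0 <= powR t b by exact: powR_ge0.
apply: le_trans (@Jt_le t delta (2 * M1) b (3 * CJ) W tau K _ _ _ _ _ _ _ _ _ _) _ => //.
- by rewrite mulr_ge0// ltW.
- move=> s s0d; have /andP[s0 _] := s0d; have := tubeM s s0d.
  by rewrite /mink_ratio lte_pdivrMr ?powR_gt0.
- by rewrite muW.
have -> : powR t (2 * n%:R - alpha) = t ^+ n * powR t b.
  rewrite -(powR_mulrn _ (ltW t0)) -powRD ?(gt_eqF t0) ?implybT//.
  by congr powR; rewrite /b; ring.
rewrite -EFinM lee_fin [leRHS]mulrCA ler_pM2l ?exprn_gt0//.
have tnb : t ^+ n <= powR t b.
  rewrite -(powR_mulrn _ (ltW t0)); apply: ger_powR; first by rewrite t0 ltW.
  by case/andP: b01 => _ b1; exact: le_trans b1 n1.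
have X0 : 0 <= (2 / delta) ^+ n by rewrite exprn_ge0// divr_ge0// ltW.
have Wtau : W * (2 / delta) ^+ n * tau <= M1 * CJ.
  rewrite /tau mulrA ler_pdivrMr// mulrC.
  apply: ler_wpM2l; first by rewrite mulr_ge0// ltW.
  by apply: ler_wpM2r => //; rewrite lerDl.
have -> : W * (2 * t / delta) ^+ n * tau = W * (2 / delta) ^+ n * tau * t ^+ n.
  by rewrite (mulrAC 2) exprMn; ring.
have -> : 7 * CJ * M1 * powR t b = 2 * M1 * powR t b * (3 * CJ) + M1 * CJ * powR t b.
  by ring.
rewrite lerD2l; apply: ler_pM => //; last by rewrite exprn_ge0// ltW.
by apply: mulr_ge0 (ltW tau0); exact: mulr_ge0.
Qed.

End upper_bound.

(** * The lower limit, with a constant independent of [alpha] *)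

Lemma min1_expr_le_powR (R : realType) (n : nat) (k b : R) : 0 < k -> 0 <= b <= 1 ->
  Num.min 1 k ^+ n.+1 <= powR k b * k ^+ n.
Proof.
move=> k0 /andP[b0 b1]; rewrite exprS.
have q0 : 0 <= Num.min 1 k by rewrite le_min ler01 ltW.
apply: ler_pM => //; first exact: exprn_ge0.
  case: (leP 1 k) => k1; first by rewrite -(powRr0 k); exact: ler_powR.
  by rewrite -{1}(powRr1 (ltW k0)); apply: ger_powR => //; rewrite k0 ltW.
by rewrite lerXn2r ?nnegrE ?(ltW k0)// ge_min lexx orbT.
Qed.

(** [Jt_ge] is applied with [r = k * t], where [k = aJ / (2 * n%:R)] is the largest ratio it admits.
    The 2 beside [6 ^+ n] comes from weakening [M2] to [M2 / 2], which makes the content bound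
    strict. *)
Lemma limf_einf_Jt_ratio_ge (R : realType) (n : nat) (n_gt0 : (0 < n)%N)
    (mu : {outer_measure set 'rV[R]_n -> \bar R})
    (muE : forall A, mu A = lebesgue_outer A)
    (Omega : set 'rV[R]_n) (J : 'rV[R]_n -> R) (alpha M2 D cJ aJ : R) :
  n%:R - 1 <= alpha <= n%:R -> bounded_set Omega ->
  (measurable : set (set (caratheodory_type mu))) Omega ->
  0 < M2 -> 0 < D -> 0 < cJ -> 0 < aJ ->
  (M2%:E <= lower_minkowski mu alpha (boundary Omega))%E ->
  (forall (x : 'rV[R]_n) (t : R), boundary Omega x -> 0 < t < 1 ->
     ((D * powR t n%:R)%:E <= mu (eball x t `&` Omega))%E /\
     ((D * powR t n%:R)%:E <= mu (eball x t `&` ~` Omega))%E) ->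
  (forall z, 0 <= J z) -> (forall z, enorm z <= aJ -> cJ <= J z) ->
  ((cJ * D ^+ 2 * Num.min 1 (aJ / (2 * n%:R)) ^+ n.+1 / (2 * 6 ^+ n) * M2)%:E
    <= limf_einf (Jt_ratio mu J Omega alpha) (0^'+))%E.
Proof.
move=> /andP[alpha1 alpha2] bOmega mOmega M20 D0 cJ0 aJ0 lM dens J0 JcJ.
pose b := n%:R - alpha.
have b01 : 0 <= b <= 1 by apply/andP; split; rewrite /b; lra.
have n0 : 0 < n%:R :> R by rewrite ltr0n.
pose k := aJ / (2 * n%:R).
have k0 : 0 < k by rewrite divr_gt0// mulr_gt0.
have : ((M2 / 2)%:E < lower_minkowski mu alpha (boundary Omega))%E.
  by apply: lt_le_trans lM; rewrite lte_fin; lra.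
move=> /limf_einf_gt/near_right0P[delta delta0 tubeM].
apply: limf_einf_ge; apply/near_right0P.
(* This ensures [r < 1] for the density hypothesis and [r < delta] for the tube bound. *)
exists (Num.min 1 delta / k); first by rewrite divr_gt0// lt_min ltr01.
move=> t /andP[t0]; rewrite ltr_pdivlMr// lt_min mulrC => /andP[r1 rdelta].
set r := k * t in r1 rdelta; have r0 : 0 < r by rewrite mulr_gt0.
rewrite /Jt_ratio lee_pdivlMr ?powR_gt0//.
have density x : boundary Omega x ->
    ((D * r ^+ n)%:E <= mu (eball x r `&` Omega))%E /\
    ((D * r ^+ n)%:E <= mu (eball x r `&` ~` Omega))%E.
  move=> bx; rewrite -(powR_mulrn _ (ltW r0)); apply: dens => //.
  by rewrite r0.
apply: le_trans (@Jt_ge R n n_gt0 mu muE Omega D r bOmega mOmega D0 r0 density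
  J cJ aJ t (M2 / 2 * powR r b) t0 cJ0 J0 JcJ _ _); last 2 first.
- by rewrite le_eqVlt; apply/orP; left; apply/eqP; rewrite /r /k; field; rewrite gt_eqF.
- have := tubeM r; rewrite r0 rdelta => /(_ isT).
  by rewrite /mink_ratio lte_pdivlMr ?powR_gt0// => /ltW.
have -> : powR t (2 * n%:R - alpha) = t ^+ n * powR t b.
  rewrite -(powR_mulrn _ (ltW t0)) -powRD ?(gt_eqF t0) ?implybT//.
  by congr powR; rewrite /b; ring.
rewrite -EFinM lee_fin /r powRM ?(ltW k0) ?(ltW t0)// exprMn -/k.
(* The exponent [b + n] of [k] varies with [alpha]; [q] is a lower bound valid for every [b] in
   [[0, 1]]. *)
set q := Num.min 1 k ^+ n.+1.
have qk : q <= powR k b * k ^+ n by exact: min1_expr_le_powR.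
have six0 : 6 ^+ n != 0 :> R by rewrite expf_neq0.
have -> : cJ * D ^+ 2 * q / (2 * 6 ^+ n) * M2 * (t ^+ n * powR t b) =
    q * (M2 * cJ * D ^+ 2 * t ^+ n * powR t b / (2 * 6 ^+ n)) by field.
have -> : M2 / 2 * (powR k b * powR t b) * (cJ * D ^+ 2 * (k ^+ n * t ^+ n) / 6 ^+ n) =
    powR k b * k ^+ n * (M2 * cJ * D ^+ 2 * t ^+ n * powR t b / (2 * 6 ^+ n)) by field.
apply: ler_wpM2r => //; apply: divr_ge0; last by rewrite mulr_ge0// exprn_ge0.
by rewrite !mulr_ge0 ?exprn_ge0 ?powR_ge0 ?(ltW M20) ?(ltW cJ0) ?(ltW D0) ?(ltW t0).
Qed.

(** * Both bounds combined, with explicit constants *)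

Theorem theorem1p1 (R : realType) (n : nat) (hn : (0 < n)%N) :
  exists (O1 : R -> R) (O2 : R -> R -> R -> R),
    (forall aJ cJ D : R, 0 < aJ -> 0 < cJ -> 0 < D -> 0 < O2 aJ cJ D) /\
    forall (mu : {outer_measure set 'rV[R]_n -> \bar R}),
      (forall A, mu A = lebesgue_outer A) ->
    forall (alpha : R) (Omega : set 'rV[R]_n) (M1 M2 D : R)
           (J : 'rV[R]_n -> R) (CJ cJ aJ : R),
      n%:R - 1 <= alpha <= n%:R ->
      bounded_set Omega ->
      (mu : set (caratheodory_type mu) -> \bar R).-cara.-measurable Omega ->
      (0 < mu Omega)%E ->
      0 < M1 -> 0 < M2 ->
      (M2%:E <= lower_minkowski mu alpha (boundary Omega))%E ->
      (lower_minkowski mu alpha (boundary Omega)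
         <= upper_minkowski mu alpha (boundary Omega))%E ->
      (upper_minkowski mu alpha (boundary Omega) <= M1%:E)%E ->
      0 < D ->
      (forall (x : 'rV[R]_n) (t : R), boundary Omega x -> 0 < t < 1 ->
         ((D * powR t n%:R)%:E <= mu (eball x t `&` Omega))%E /\
         ((D * powR t n%:R)%:E <= mu (eball x t `&` ~` Omega))%E) ->
      (forall z, 0 <= J z) ->
      (mu : set (caratheodory_type mu) -> \bar R).-integrable setT
         (fun z => (J z)%:E) ->
      (\int[mu : set (caratheodory_type mu) -> \bar R]_z
          (J z * powR (enorm z) n%:R)%:E < +oo)%E ->
      0 < CJ ->
      (forall gamma, 0 <= gamma <= n%:R ->
         (\int[mu : set (caratheodory_type mu) -> \bar R]_z
            (J z * powR (enorm z) gamma)%:E <= CJ%:E)%E) ->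
      0 < cJ -> 0 < aJ ->
      (forall z, enorm z <= aJ -> cJ <= J z) ->
      [/\ (0 < (O2 aJ cJ D * M2)%:E)%E,
          ((O2 aJ cJ D * M2)%:E
             <= limf_einf (Jt_ratio mu J Omega alpha) (0^'+))%E,
          (limf_einf (Jt_ratio mu J Omega alpha) (0^'+)
             <= limf_esup (Jt_ratio mu J Omega alpha) (0^'+))%E,
          (limf_esup (Jt_ratio mu J Omega alpha) (0^'+)
             <= (O1 CJ * M1)%:E)%E &
          ((O1 CJ * M1)%:E < +oo)%E].
Proof.
exists (fun CJ => 7 * CJ), (fun aJ cJ D =>
  cJ * D ^+ 2 * Num.min 1 (aJ / (2 * n%:R)) ^+ n.+1 / (2 * 6 ^+ n)).
have O2_gt0 aJ cJ D : 0 < aJ -> 0 < cJ -> 0 < D ->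
    0 < cJ * D ^+ 2 * Num.min 1 (aJ / (2 * n%:R)) ^+ n.+1 / (2 * 6 ^+ n) :> R.
  move=> aJ0 cJ0 D0; rewrite divr_gt0 ?mulr_gt0 ?exprn_gt0//.
  by rewrite lt_min ltr01 divr_gt0// mulr_gt0// ltr0n.
split; first exact: O2_gt0.
move=> mu muE alpha Omega M1 M2 D J CJ cJ aJ alphan bOmega mOmega _ M10 M20.
move=> lM _ uM D0 dens J0 iJ _ CJ0 JCJ cJ0 aJ0 JcJ.
have mJ := measurable_int _ iJ.
split.
- by rewrite lte_fin mulr_gt0// O2_gt0.
- exact: limf_einf_Jt_ratio_ge.
- exact: limf_einf_le_esup.
- apply: limf_esup_Jt_ratio_le => //.
  exact/measurable_EFinP.
- exact: ltry.
Qed.
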